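(* Let $v(y,t)=u^z(1,y,t)$, and assume $v$ is odd in $y$, so that $v_{yy}(0,t)=0$. Then for the boundary transport equation $\Gamma_t+v\Gamma_y=0$ (for $\Gamma(1,y,t)$) at $y=0$, the curvature ratio $$Q(t)=\frac{\Gamma_*\,\Gamma_{yy}(1,0,t)}{\Gamma_y(1,0,t)^2}$$ is constant in time. In particular, if $Q(0)>-1+\varepsilon$, then $$a'(t)\ge\sigma(t)a(t)+2\varepsilon b(t)^2.$$
   Context: $u=u^re_r+u^\theta e_\theta+u^ze_z$ is a smooth axisymmetric Euler solution with swirl in the periodic cylinder $\{0<r<1,\ z\in\mathbb T\}$, with $u^r(1,z,t)=0$. $\Gamma=ru^\theta$ and $G=\omega^\theta/r$ (with $\omega^\theta=\partial_zu^r-\partial_ru^z$) satisfy $D_t\Gamma=0$, $D_tG=r^{-4}\partial_z(\Gamma^2)$, where $D_t=\partial_t+u^r\partial_r+u^z\partial_z$. Here $y=z$; $\sigma(t)=-\partial_zu^z(1,0,t)$, $a(t)=\partial_zG(1,0,t)$, $b(t)=\partial_z\Gamma(1,0,t)$ (nonzero, so that $Q$ is defined). The boundary point is fixed: $u^r(1,0,t)=u^z(1,0,t)=0$. $\Gamma_*:=\Gamma(1,0,0)>0$, which equals $\Gamma(1,0,t)$ for all $t$. *)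

(* Defs.v *)
From Stdlib Require Import Reals List.
From Coquelicot Require Import Coquelicot.

Open Scope R_scope.

(* Scalar fields f r z t in cylindrical coordinates (no dependence on theta). *)
Definition field := R -> R -> R -> R.

Inductive coord := Cr | Cz | Ct.

Definition along (d : coord) (f : field) (r z t : R) : R -> R :=
  match d with
  | Cr => fun s => f s z t
  | Cz => fun s => f r s t
  | Ct => fun s => f r z s
  end.

Definition coord_val (d : coord) (r z t : R) : R :=
  match d with Cr => r | Cz => z | Ct => t end.

Definition pd (d : coord) (f : field) : field :=
  fun r z t => Derive (along d f r z t) (coord_val d r z t).

Definition pds (w : list coord) (f : field) : field := fold_right pd f w.

Definition uncurry3 (f : field) (q : R * R * R) : R :=
  f (fst (fst q)) (snd (fst q)) (snd q).

(* [Derive] is total, so existence of every iterated partial derivative has to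
   be required along with its continuity. *)
Definition smooth_on_open (O : R * R * R -> Prop) (f : field) : Prop :=
  forall (w : list coord) (r z t : R), O (r, z, t) ->
    continuous (uncurry3 (pds w f)) (r, z, t) /\
    forall d : coord,
      ex_derive (along d (pds w f) r z t) (coord_val d r z t).

(* Smoothness up to the boundary: C^infinity on some open neighbourhood of the
   region.  The derivatives at r = 1 and at t = 0 are then the one-sided ones,
   and do not depend on the values of f outside the region. *)
Definition smooth_on (S : R * R * R -> Prop) (f : field) : Prop :=
  exists O : R * R * R -> Prop,
    open O /\ (forall q, S q -> O q) /\ smooth_on_open O f.

(* The fluid domain with its wall r = 1, over the time interval [0, T);
   the torus is R modulo the period of the fields in z. *)
Definition region (T : R) (q : R * R * R) : Prop :=
  0 < fst (fst q) <= 1 /\ 0 <= snd q < T.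

Definition z_periodic (L T : R) (f : field) : Prop :=
  forall r z t, region T (r, z, t) -> f r (z + L) t = f r z t.

Definition material (ur uz f : field) : field := fun r z t =>
  pd Ct f r z t + ur r z t * pd Cr f r z t + uz r z t * pd Cz f r z t.

(* u = ur e_r + ut e_theta + uz e_z with pressure p; the terms without
   derivatives come from differentiating e_r and e_theta in theta. *)
Record axisymmetric_euler (L T : R) (ur ut uz p : field) : Prop := {
  euler_smooth : forall f, In f (ur :: ut :: uz :: p :: nil) ->
    smooth_on (region T) f;
  euler_periodic : forall f, In f (ur :: ut :: uz :: p :: nil) ->
    z_periodic L T f;
  euler_momentum_r : forall r z t, 0 < r < 1 -> 0 <= t < T ->
    material ur uz ur r z t - (ut r z t) ^ 2 / r = - pd Cr p r z t;
  euler_momentum_theta : forall r z t, 0 < r < 1 -> 0 <= t < T ->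
    material ur uz ut r z t + ur r z t * ut r z t / r = 0;
  euler_momentum_z : forall r z t, 0 < r < 1 -> 0 <= t < T ->
    material ur uz uz r z t = - pd Cz p r z t;
  euler_incompressible : forall r z t, 0 < r < 1 -> 0 <= t < T ->
    pd Cr ur r z t + ur r z t / r + pd Cz uz r z t = 0;
  euler_no_penetration : forall z t, 0 <= t < T -> ur 1 z t = 0
}.

Definition Gam (ut : field) : field := fun r z t => r * ut r z t.

Definition omega_theta (ur uz : field) : field := fun r z t =>
  pd Cz ur r z t - pd Cr uz r z t.

Definition G (ur uz : field) : field := fun r z t => omega_theta ur uz r z t / r.

Definition sigma_wall (uz : field) (t : R) : R := - pd Cz uz 1 0 t.

Definition a (ur uz : field) (t : R) : R := pd Cz (G ur uz) 1 0 t.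

Definition b (ut : field) (t : R) : R := pd Cz (Gam ut) 1 0 t.

Definition Gam_star (ut : field) : R := Gam ut 1 0 0.

Definition Q (ut : field) (t : R) : R :=
  Gam_star ut * pd Cz (pd Cz (Gam ut)) 1 0 t / (b ut t) ^ 2.

(* Main.v *)
Require Import Defs.
From Stdlib Require Import Reals List Lra.
From Coquelicot Require Import Coquelicot.

Open Scope R_scope.

(** The wall [r = 1] carries its own closed system. No flow crosses it, so
    [ur] and its [z]-derivatives vanish there, and with [v = uz] on the wall the
    swirl obeys [ut_t + v ut_z = 0]. Differentiate this once and twice in [z] at
    the fixed point [z = 0], where [v = 0], and where [v_zz = 0] because [v] is
    odd. With [sigma = - v_z] this gives
<<
      (ut_z)_t = sigma ut_z,      (ut_zz)_t = 2 sigma ut_zz,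
>>
    while [ut] itself stays constant in time. On the wall [Gam] and its
    [z]-derivatives are those of [ut], so [Q], a constant times
    [ut_zz / ut_z ^ 2], does not move ([is_derive_growth_ratio]).

    For the growth of [a], the vorticity equation is split into the two momentum
    equations that produce it. On the wall the radial one reduces to
    [ur_t - ut ^ 2 + p_r = 0] ([wall_radial_momentum]). The axial one is
    differentiated in [r] in the interior before passing to the wall; the terms
    [ur_r uz_r + uz_r uz_z] cancel there since incompressibility reads
    [ur_r + uz_z = 0], and what remains is transport of the wall shear [uz_r],
    forced by the pressure ([wall_shear_transport]). Two [z]-derivatives of the
    first and one of the second both contain [p_rzz], which disappears from the
    difference. Since [a = ur_zz - uz_rz] at the fixed point, with [ur_zz = 0],
    the outcome is ([a_derivative])
<<
      a' = sigma a + 2 (ut_z ^ 2 + ut ut_zz) = sigma a + 2 b ^ 2 (1 + Q),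
>>
    and [1 + Q > eps] is preserved because [Q] is constant.

    The equations are assumed only for [0 < r < 1]. They reach the wall by
    continuity ([zero_at_wall]), and along the wall they are differentiated in
    [z] only, never in [t], so that [t = 0] needs no special treatment. Time
    derivatives come out by commuting partial derivatives ([pd_comm]) on an open
    neighbourhood where all four fields are smooth. *)

(** * Calculus on a line *)

Lemma zero_at_wall (h : R -> R) :
  ex_derive h 1 -> (forall r, 0 < r < 1 -> h r = 0) -> h 1 = 0.
Proof.
intros Hd H0.
apply (filterlim_locally_unique (F := at_left 1) h).
- exact (filterlim_filter_le_1 h (filter_le_within (F := locally 1) _)
    (ex_derive_continuous h 1 Hd)).
- apply filterlim_ext_loc with (fun _ => 0); [|apply filterlim_const].
  exists (mkposreal 1 Rlt_0_1); intros r Hr Hr1.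
  symmetry; apply H0; split; [|exact Hr1].
  change (Rabs (r - 1) < 1) in Hr; apply Rabs_def2 in Hr; lra.
Qed.

Lemma is_derive_zero_fun (h : R -> R) (x l : R) :
  locally x (fun s => h s = 0) -> is_derive h x l -> l = 0.
Proof.
intros H Hl.
rewrite <- (is_derive_unique _ _ _ Hl), (Derive_ext_loc h (fun _ => 0)) by exact H.
apply Derive_const.
Qed.

Lemma Derive_reflection (v : R -> R) (y : R) :
  ex_derive v (- y) -> Derive (fun s => v (- s)) y = - Derive v (- y).
Proof.
intros Hv; apply is_derive_unique; auto_derive; [exact Hv | change (fun x => v x) with v; ring].
Qed.

(** The derivative of an odd function is even, and that of an even function
    vanishes at the origin. *)
Lemma odd_second_derivative (v : R -> R) :
  (forall y, ex_derive v y) -> ex_derive (Derive v) 0 ->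
  (forall y, v (- y) = - v y) -> Derive (Derive v) 0 = 0.
Proof.
intros Hv Hv' Hodd.
assert (Heven : forall y, Derive v (- y) = Derive v y).
{ intros y; generalize (Derive_reflection v y (Hv _)).
  rewrite (Derive_ext _ (fun s => - v s) y Hodd), Derive_opp; lra. }
assert (H : ex_derive (Derive v) (- 0)) by (rewrite Ropp_0; exact Hv').
apply Derive_reflection in H.
rewrite (Derive_ext _ (Derive v) 0 Heven), Ropp_0 in H; lra.
Qed.

Lemma constant_of_zero_derivative (T : R) (h : R -> R) :
  (forall t, 0 <= t < T -> is_derive h t 0) ->
  forall t, 0 <= t < T -> h t = h 0.
Proof.
intros Hd t [[Ht|<-] HtT]; [|reflexivity].
symmetry; apply eq_is_derive; [|exact Ht].
intros s Hs; apply Hd; lra.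
Qed.

(** A quantity growing at rate [2 * k] against the square of one growing at
    rate [k]: the two rates cancel. *)
Lemma is_derive_growth_ratio (f g : R -> R) (t k : R) :
  is_derive f t (k * f t) -> is_derive g t (2 * k * g t) -> f t <> 0 ->
  is_derive (fun s => g s / f s ^ 2) t 0.
Proof.
intros Df Dg Hf.
assert (Hf2 : f t ^ 2 <> 0) by (apply pow_nonzero; exact Hf).
auto_derive.
- repeat split; [eexists; exact Dg | eexists; exact Df | simpl in Hf2; exact Hf2].
- change (fun x => f x) with f; change (fun x => g x) with g.
  rewrite (is_derive_unique _ _ _ Df), (is_derive_unique _ _ _ Dg).
  field; exact Hf.
Qed.

(** * Partial derivatives of smooth fields *)

Lemma smooth_on_open_subset (O O' : R * R * R -> Prop) (f : field) :
  (forall q, O' q -> O q) -> smooth_on_open O f -> smooth_on_open O' f.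
Proof. intros H Hf w r z t Hq; exact (Hf w r z t (H _ Hq)). Qed.

Lemma smooth_on_open_pd (O : R * R * R -> Prop) (d : coord) (f : field) :
  smooth_on_open O f -> smooth_on_open O (pd d f).
Proof.
intros Hf w r z t Hq.
replace (pds w (pd d f)) with (pds (w ++ d :: nil) f)
  by (unfold pds; rewrite fold_right_app; reflexivity).
exact (Hf _ r z t Hq).
Qed.

Lemma is_derive_pd (O : R * R * R -> Prop) (f : field) (d : coord) (r z t : R) :
  smooth_on_open O f -> O (r, z, t) ->
  is_derive (along d f r z t) (coord_val d r z t) (pd d f r z t).
Proof. intros Hf Hq; apply Derive_correct, (Hf nil r z t Hq). Qed.

Lemma continuous_triple {U : UniformSpace} (x y z : U -> R) (q : U) :
  continuous x q -> continuous y q -> continuous z q ->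
  continuous (fun w => (x w, y w, z w)) q.
Proof.
intros Hx Hy Hz P [e He].
generalize (filter_and _ _ (proj1 (filterlim_locally x _) Hx e)
  (filter_and _ _ (proj1 (filterlim_locally y _) Hy e)
    (proj1 (filterlim_locally z _) Hz e))).
unfold filtermap; apply filter_imp; intros w [Bx [By Bz]].
apply He; repeat split; assumption.
Qed.

(** A coordinate plane of space is a slice [e]; along it openness and continuity
    in space become the planar notions that the symmetry of second derivatives
    asks for. *)
Lemma locally_2d_slice (O : R * R * R -> Prop) (e : R * R -> R * R * R) (x y : R) :
  open O -> continuous e (x, y) -> O (e (x, y)) ->
  locally_2d (fun u v => O (e (u, v))) x y.
Proof.
intros HO He Hq; apply locally_2d_locally.
generalize (He O (HO _ Hq)); unfold filtermap; apply filter_imp.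
intros [u v]; exact (fun H => H).
Qed.

Lemma continuity_2d_slice (f : field) (e : R * R -> R * R * R) (x y : R) :
  continuous e (x, y) -> continuous (uncurry3 f) (e (x, y)) ->
  continuity_2d_pt (fun u v => uncurry3 f (e (u, v))) x y.
Proof.
intros He Hf; apply continuity_2d_pt_filterlim.
apply (filterlim_ext (fun w => uncurry3 f (e w))); [intros [u v]; reflexivity|].
exact (continuous_comp e (uncurry3 f) (x, y) He Hf).
Qed.

(** Here [d1] and [d2] are the directions that the two arguments of the slice [e]
    follow; the words in them name the derivatives that the planar theorem needs. *)
Ltac schwarz_in_slice e x y d1 d2 HO Hf Hq :=
  let He := fresh "He" in
  assert (He : continuous e (x, y))
    by (apply continuous_triple;
        first [apply continuous_fst | apply continuous_snd | apply continuous_const]);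
  apply (Schwarz (fun u v => uncurry3 _ (e (u, v))) x y);
  [ generalize (locally_2d_slice _ e x y HO He Hq); apply locally_2d_impl;
    apply locally_2d_forall; intros u v Huv; repeat split;
    [ exact (proj2 (Hf nil _ _ _ Huv) d1)
    | exact (proj2 (Hf nil _ _ _ Huv) d2)
    | exact (proj2 (Hf (d2 :: nil) _ _ _ Huv) d1)
    | exact (proj2 (Hf (d1 :: nil) _ _ _ Huv) d2) ]
  | exact (continuity_2d_slice _ e x y He (proj1 (Hf (d1 :: d2 :: nil) _ _ _ Hq)))
  | exact (continuity_2d_slice _ e x y He (proj1 (Hf (d2 :: d1 :: nil) _ _ _ Hq))) ].

Lemma pd_comm (O : R * R * R -> Prop) (f : field) (d1 d2 : coord) (r z t : R) :
  open O -> smooth_on_open O f -> O (r, z, t) ->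
  pd d1 (pd d2 f) r z t = pd d2 (pd d1 f) r z t.
Proof.
intros HO Hf Hq.
pose (rz := fun w : R * R => (fst w, snd w, t)).
pose (rt := fun w : R * R => (fst w, z, snd w)).
pose (zt := fun w : R * R => (r, fst w, snd w)).
assert (Hrz : pd Cr (pd Cz f) r z t = pd Cz (pd Cr f) r z t)
  by schwarz_in_slice rz r z Cr Cz HO Hf Hq.
assert (Hrt : pd Cr (pd Ct f) r z t = pd Ct (pd Cr f) r z t)
  by schwarz_in_slice rt r t Cr Ct HO Hf Hq.
assert (Hzt : pd Cz (pd Ct f) r z t = pd Ct (pd Cz f) r z t)
  by schwarz_in_slice zt z t Cz Ct HO Hf Hq.
destruct d1, d2; congruence.
Qed.

Lemma ex_derive_pd (O : R * R * R -> Prop) (f : field) (d : coord) (r z t : R) :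
  smooth_on_open O f -> O (r, z, t) ->
  ex_derive (along d f r z t) (coord_val d r z t).
Proof. intros Hf Hq; exact (proj2 (Hf nil r z t Hq) d). Qed.

(** * The equations on the wall *)

(** Each field comes with its own neighbourhood of smoothness; products of fields
    and of their derivatives need a common one. *)
Record smooth_flow_near_region (O : R * R * R -> Prop) (T : R)
  (ur ut uz p : field) : Prop := {
  flow_open : open O;
  flow_region : forall q, region T q -> O q;
  flow_ur : smooth_on_open O ur;
  flow_ut : smooth_on_open O ut;
  flow_uz : smooth_on_open O uz;
  flow_p : smooth_on_open O p
}.

Lemma euler_smooth_flow (L T : R) (ur ut uz p : field) :
  axisymmetric_euler L T ur ut uz p ->
  exists O, smooth_flow_near_region O T ur ut uz p.
Proof.
intros E; assert (S := euler_smooth _ _ _ _ _ _ E).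
destruct (S ur) as [O1 [Ho1 [Hr1 H1]]]; [simpl; tauto|].
destruct (S ut) as [O2 [Ho2 [Hr2 H2]]]; [simpl; tauto|].
destruct (S uz) as [O3 [Ho3 [Hr3 H3]]]; [simpl; tauto|].
destruct (S p) as [O4 [Ho4 [Hr4 H4]]]; [simpl; tauto|].
exists (fun q => (O1 q /\ O2 q) /\ (O3 q /\ O4 q)); split.
- repeat apply open_and; assumption.
- intros q Hq; auto.
- apply smooth_on_open_subset with O1; [tauto | exact H1].
- apply smooth_on_open_subset with O2; [tauto | exact H2].
- apply smooth_on_open_subset with O3; [tauto | exact H3].
- apply smooth_on_open_subset with O4; [tauto | exact H4].
Qed.

Lemma flow_at (O : R * R * R -> Prop) (T : R) (ur ut uz p : field) (r z t : R) :
  smooth_flow_near_region O T ur ut uz p -> 0 < r <= 1 -> 0 <= t < T ->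
  O (r, z, t).
Proof. intros F Hr Ht; apply (flow_region _ _ _ _ _ _ F); split; assumption. Qed.

Create HintDb flow.
#[local] Hint Resolve flow_open flow_ur flow_ut flow_uz flow_p smooth_on_open_pd : flow.

Ltac in_flow := solve [eapply flow_at; [eassumption | lra | assumption] | eauto with flow].

(** Unification does not recover the coordinate direction from a section of a
    field, so it is read off from the place of the bound variable. *)
Ltac differentiable :=
  match goal with
  | |- ex_derive (fun s => ?f s ?z ?t) ?r =>
      eapply (ex_derive_pd _ f Cr r z t); in_flow
  | |- ex_derive (fun s => ?f ?r s ?t) ?z =>
      eapply (ex_derive_pd _ f Cz r z t); in_flow
  | |- ex_derive (fun s => ?f ?r ?z s) ?t =>
      eapply (ex_derive_pd _ f Ct r z t); in_flow
  end.

Ltac derive_product_rule :=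
  auto_derive;
  [ repeat split; try lra; differentiable
  | unfold pd; simpl; ring ].

Section Wall.
Variables (L T : R) (ur ut uz p : field) (O : R * R * R -> Prop).
Hypothesis E : axisymmetric_euler L T ur ut uz p.
Hypothesis F : smooth_flow_near_region O T ur ut uz p.

Lemma wall_ur_z (z t : R) : 0 <= t < T -> pd Cz ur 1 z t = 0.
Proof.
intros Ht; unfold pd; simpl.
rewrite (Derive_ext _ (fun _ => 0)); [apply Derive_const|].
intros s; apply (euler_no_penetration _ _ _ _ _ _ E s t Ht).
Qed.

Lemma wall_incompressible (z t : R) : 0 <= t < T ->
  pd Cr ur 1 z t + pd Cz uz 1 z t = 0.
Proof.
intros Ht.
assert (H := zero_at_wall
  (fun r => pd Cr ur r z t + ur r z t / r + pd Cz uz r z t)).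
simpl in H; rewrite (euler_no_penetration _ _ _ _ _ _ E z t Ht) in H.
rewrite <- H; [field| |].
- auto_derive; repeat split; try lra; differentiable.
- intros r Hr; apply (euler_incompressible _ _ _ _ _ _ E r z t Hr Ht).
Qed.

(** Both the radial transport and the term [ur ut / r] carry the factor [ur]. *)
Lemma wall_swirl_transport (z t : R) : 0 <= t < T ->
  pd Ct ut 1 z t + uz 1 z t * pd Cz ut 1 z t = 0.
Proof.
intros Ht.
assert (H := zero_at_wall
  (fun r => material ur uz ut r z t + ur r z t * ut r z t / r)).
unfold material in H; simpl in H.
rewrite (euler_no_penetration _ _ _ _ _ _ E z t Ht) in H.
rewrite <- H; [field| |].
- auto_derive; repeat split; try lra; differentiable.
- intros r Hr; apply (euler_momentum_theta _ _ _ _ _ _ E r z t Hr Ht).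
Qed.

(** Radial transport dies with [ur], axial transport with [ur_z]; the centrifugal
    term survives, and is the source of the growth of [a]. *)
Lemma wall_radial_momentum (z t : R) : 0 <= t < T ->
  pd Ct ur 1 z t - ut 1 z t * ut 1 z t + pd Cr p 1 z t = 0.
Proof.
intros Ht.
assert (H := zero_at_wall
  (fun r => material ur uz ur r z t - ut r z t ^ 2 / r + pd Cr p r z t)).
unfold material in H; cbv beta in H.
rewrite (euler_no_penetration _ _ _ _ _ _ E z t Ht), (wall_ur_z z t Ht) in H.
rewrite <- H; [field| |].
- auto_derive; repeat split; try lra; differentiable.
- intros r Hr.
  assert (M := euler_momentum_r _ _ _ _ _ _ E r z t Hr Ht).
  unfold material in M; rewrite M; ring.
Qed.

(** The [r]-derivative of the axial momentum equation. It has to be taken in the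
    interior, since the wall equation alone knows nothing about [r]. *)
Lemma interior_shear (r z t : R) : 0 < r < 1 -> 0 <= t < T ->
  pd Cr (pd Ct uz) r z t
  + (pd Cr ur r z t * pd Cr uz r z t + ur r z t * pd Cr (pd Cr uz) r z t)
  + (pd Cr uz r z t * pd Cz uz r z t + uz r z t * pd Cr (pd Cz uz) r z t)
  + pd Cr (pd Cz p) r z t = 0.
Proof.
intros Hr Ht.
apply (is_derive_zero_fun
  (fun s => material ur uz uz s z t + pd Cz p s z t) r).
- assert (Hloc : locally r (fun s => 0 < s < 1))
    by exact (open_and _ _ (open_gt 0) (open_lt 1) r Hr).
  revert Hloc; apply filter_imp; intros s Hs.
  rewrite (euler_momentum_z _ _ _ _ _ _ E s z t Hs Ht); ring.
- unfold material; derive_product_rule.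
Qed.

(** Stretching [uz_r uz_z] and compression [ur_r uz_r] balance by
    incompressibility, so the wall shear [uz_r] is only transported and forced. *)
Lemma wall_shear_transport (z t : R) : 0 <= t < T ->
  pd Cr (pd Ct uz) 1 z t + uz 1 z t * pd Cr (pd Cz uz) 1 z t
  + pd Cr (pd Cz p) 1 z t = 0.
Proof.
intros Ht.
assert (H := zero_at_wall (fun r =>
  pd Cr (pd Ct uz) r z t
  + (pd Cr ur r z t * pd Cr uz r z t + ur r z t * pd Cr (pd Cr uz) r z t)
  + (pd Cr uz r z t * pd Cz uz r z t + uz r z t * pd Cr (pd Cz uz) r z t)
  + pd Cr (pd Cz p) r z t)).
cbv beta in H.
rewrite (euler_no_penetration _ _ _ _ _ _ E z t Ht) in H.
replace (pd Cr ur 1 z t) with (- pd Cz uz 1 z t) in H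
  by (generalize (wall_incompressible z t Ht); lra).
rewrite <- H; [ring| |].
- auto_derive; repeat split; differentiable.
- intros r Hr; exact (interior_shear r z t Hr Ht).
Qed.

(** * Derivatives along the wall *)

Lemma wall_swirl_transport_z (z t : R) : 0 <= t < T ->
  pd Cz (pd Ct ut) 1 z t
  + (pd Cz uz 1 z t * pd Cz ut 1 z t + uz 1 z t * pd Cz (pd Cz ut) 1 z t) = 0.
Proof.
intros Ht.
apply (is_derive_zero_fun
  (fun s => pd Ct ut 1 s t + uz 1 s t * pd Cz ut 1 s t) z).
- apply filter_forall; intros s; exact (wall_swirl_transport s t Ht).
- derive_product_rule.
Qed.

Lemma wall_swirl_transport_zz (z t : R) : 0 <= t < T ->
  pd Cz (pd Cz (pd Ct ut)) 1 z t
  + (pd Cz (pd Cz uz) 1 z t * pd Cz ut 1 z t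
     + 2 * pd Cz uz 1 z t * pd Cz (pd Cz ut) 1 z t
     + uz 1 z t * pd Cz (pd Cz (pd Cz ut)) 1 z t) = 0.
Proof.
intros Ht.
apply (is_derive_zero_fun
  (fun s => pd Cz (pd Ct ut) 1 s t
     + (pd Cz uz 1 s t * pd Cz ut 1 s t + uz 1 s t * pd Cz (pd Cz ut) 1 s t)) z).
- apply filter_forall; intros s; exact (wall_swirl_transport_z s t Ht).
- derive_product_rule.
Qed.

Lemma wall_radial_momentum_zz (z t : R) : 0 <= t < T ->
  pd Cz (pd Cz (pd Ct ur)) 1 z t
  - 2 * (pd Cz ut 1 z t ^ 2 + ut 1 z t * pd Cz (pd Cz ut) 1 z t)
  + pd Cz (pd Cz (pd Cr p)) 1 z t = 0.
Proof.
intros Ht.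
assert (Hz : forall s, pd Cz (pd Ct ur) 1 s t
    - 2 * (ut 1 s t * pd Cz ut 1 s t) + pd Cz (pd Cr p) 1 s t = 0).
{ intros s.
  apply (is_derive_zero_fun
    (fun x => pd Ct ur 1 x t - ut 1 x t * ut 1 x t + pd Cr p 1 x t) s).
  - apply filter_forall; intros x; exact (wall_radial_momentum x t Ht).
  - derive_product_rule. }
apply (is_derive_zero_fun
  (fun s => pd Cz (pd Ct ur) 1 s t
    - 2 * (ut 1 s t * pd Cz ut 1 s t) + pd Cz (pd Cr p) 1 s t) z).
- apply filter_forall; exact Hz.
- derive_product_rule.
Qed.

Lemma wall_shear_transport_z (z t : R) : 0 <= t < T ->
  pd Cz (pd Cr (pd Ct uz)) 1 z t
  + (pd Cz uz 1 z t * pd Cr (pd Cz uz) 1 z t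
     + uz 1 z t * pd Cz (pd Cr (pd Cz uz)) 1 z t)
  + pd Cz (pd Cr (pd Cz p)) 1 z t = 0.
Proof.
intros Ht.
apply (is_derive_zero_fun
  (fun s => pd Cr (pd Ct uz) 1 s t + uz 1 s t * pd Cr (pd Cz uz) 1 s t
     + pd Cr (pd Cz p) 1 s t) z).
- apply filter_forall; intros s; exact (wall_shear_transport s t Ht).
- derive_product_rule.
Qed.

Lemma wall_pd_comm (f : field) (d1 d2 : coord) (z t : R) :
  smooth_on_open O f -> 0 <= t < T ->
  pd d1 (pd d2 f) 1 z t = pd d2 (pd d1 f) 1 z t.
Proof. intros Hf Ht; apply (pd_comm O); in_flow. Qed.

Lemma wall_pd_comm_under_z (f : field) (d1 d2 : coord) (z t : R) :
  smooth_on_open O f -> 0 <= t < T ->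
  pd Cz (pd d1 (pd d2 f)) 1 z t = pd Cz (pd d2 (pd d1 f)) 1 z t.
Proof.
intros Hf Ht; apply Derive_ext; intros s; exact (wall_pd_comm f d1 d2 s t Hf Ht).
Qed.

(** * Evolution at the fixed boundary point *)

Hypothesis Hfixed : forall t, 0 <= t < T -> uz 1 0 t = 0.

Lemma swirl_derivative_at_fixed_point (t : R) : 0 <= t < T ->
  is_derive (fun s => ut 1 0 s) t 0.
Proof.
intros Ht.
assert (D := is_derive_pd O ut Ct 1 0 t ltac:(in_flow) ltac:(in_flow)).
assert (D0 : pd Ct ut 1 0 t = 0)
  by (generalize (wall_swirl_transport 0 t Ht); rewrite (Hfixed t Ht); lra).
rewrite D0 in D; exact D.
Qed.

Lemma swirl_z_derivative_at_fixed_point (t : R) : 0 <= t < T ->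
  is_derive (fun s => pd Cz ut 1 0 s) t (sigma_wall uz t * pd Cz ut 1 0 t).
Proof.
intros Ht.
replace (sigma_wall uz t * pd Cz ut 1 0 t) with (pd Ct (pd Cz ut) 1 0 t).
- apply (is_derive_pd O (pd Cz ut) Ct 1 0 t); in_flow.
- rewrite (wall_pd_comm ut Ct Cz) by in_flow.
  generalize (wall_swirl_transport_z 0 t Ht).
  rewrite (Hfixed t Ht); unfold sigma_wall; lra.
Qed.

Lemma swirl_zz_derivative_at_fixed_point (t : R) : 0 <= t < T ->
  pd Cz (pd Cz uz) 1 0 t = 0 ->
  is_derive (fun s => pd Cz (pd Cz ut) 1 0 s) t
    (2 * sigma_wall uz t * pd Cz (pd Cz ut) 1 0 t).
Proof.
intros Ht Hzz.
replace (2 * sigma_wall uz t * pd Cz (pd Cz ut) 1 0 t)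
  with (pd Ct (pd Cz (pd Cz ut)) 1 0 t).
- apply (is_derive_pd O (pd Cz (pd Cz ut)) Ct 1 0 t); in_flow.
- rewrite (wall_pd_comm (pd Cz ut) Ct Cz), (wall_pd_comm_under_z ut Ct Cz) by in_flow.
  generalize (wall_swirl_transport_zz 0 t Ht).
  rewrite (Hfixed t Ht), Hzz; unfold sigma_wall; lra.
Qed.

Lemma pd_z_G (r z t : R) : O (r, z, t) ->
  pd Cz (G ur uz) r z t = (pd Cz (pd Cz ur) r z t - pd Cz (pd Cr uz) r z t) / r.
Proof.
intros Hq; apply is_derive_unique.
unfold along, G, omega_theta, Rdiv.
apply (is_derive_ext (fun s => / r * (pd Cz ur r s t - pd Cr uz r s t)));
  [intros; apply Rmult_comm|].
rewrite Rmult_comm; apply is_derive_scal.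
apply @is_derive_minus.
- apply (is_derive_pd O (pd Cz ur) Cz r z t); [in_flow | exact Hq].
- apply (is_derive_pd O (pd Cr uz) Cz r z t); [in_flow | exact Hq].
Qed.

(** The term [ur_zz] of the vorticity gradient vanishes with [ur] along the wall. *)
Lemma a_wall (t : R) : 0 <= t < T -> a ur uz t = - pd Cz (pd Cr uz) 1 0 t.
Proof.
intros Ht; unfold a; rewrite pd_z_G by in_flow.
replace (pd Cz (pd Cz ur) 1 0 t) with 0; [field|].
unfold pd at 1; symmetry; apply is_derive_unique.
apply (is_derive_ext (fun _ => 0)); [|apply @is_derive_const].
intros s; symmetry; exact (wall_ur_z s t Ht).
Qed.

(** The time derivative of [ur_zz] is kept, although [ur_zz] vanishes on the wall
    for [0 <= t < T]: [Derive] is two-sided, also at [t = 0], and the radial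
    momentum equation supplies the exact value in every case. *)
Lemma a_derivative (t : R) : 0 <= t < T ->
  is_derive (a ur uz) t
    (sigma_wall uz t * a ur uz t
     + 2 * (pd Cz ut 1 0 t ^ 2 + ut 1 0 t * pd Cz (pd Cz ut) 1 0 t)).
Proof.
intros Ht.
(* Near t = 0 the times on both sides matter, so the formula for a is used on
   the neighbourhood O and not only on the region. *)
apply (is_derive_ext_loc
  (fun s => pd Cz (pd Cz ur) 1 0 s - pd Cz (pd Cr uz) 1 0 s)).
{ assert (Hc : continuous (fun s : R => (1, 0, s)) t)
    by (apply continuous_triple;
        [apply continuous_const | apply continuous_const | apply continuous_id]).
  assert (Hq : O (1, 0, t)) by in_flow.
  generalize (Hc O (flow_open _ _ _ _ _ _ F _ Hq)).
  unfold filtermap; apply filter_imp; intros s Hs.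
  unfold a; rewrite pd_z_G by exact Hs; symmetry; apply Rdiv_1_r. }
replace (sigma_wall uz t * a ur uz t
    + 2 * (pd Cz ut 1 0 t ^ 2 + ut 1 0 t * pd Cz (pd Cz ut) 1 0 t))
  with (pd Ct (pd Cz (pd Cz ur)) 1 0 t - pd Ct (pd Cz (pd Cr uz)) 1 0 t).
- apply @is_derive_minus.
  + apply (is_derive_pd O (pd Cz (pd Cz ur)) Ct 1 0 t); in_flow.
  + apply (is_derive_pd O (pd Cz (pd Cr uz)) Ct 1 0 t); in_flow.
- rewrite (wall_pd_comm (pd Cz ur) Ct Cz), (wall_pd_comm_under_z ur Ct Cz),
    (wall_pd_comm (pd Cr uz) Ct Cz), (wall_pd_comm_under_z uz Ct Cr) by in_flow.
  rewrite (a_wall t Ht), (wall_pd_comm uz Cz Cr) by in_flow.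
  (* Rewriting both pressure terms to p_rzz lets them cancel. *)
  generalize (wall_radial_momentum_zz 0 t Ht) (wall_shear_transport_z 0 t Ht).
  rewrite (wall_pd_comm_under_z p Cz Cr) by in_flow.
  rewrite (Hfixed t Ht); unfold sigma_wall; lra.
Qed.
End Wall.

Lemma b_Gam (ut : field) (t : R) : b ut t = pd Cz ut 1 0 t.
Proof.
unfold b, pd at 1, Gam; simpl; rewrite Derive_scal; apply Rmult_1_l.
Qed.

Lemma Gam_zz (ut : field) (z t : R) :
  pd Cz (pd Cz (Gam ut)) 1 z t = pd Cz (pd Cz ut) 1 z t.
Proof.
apply Derive_ext; intros s.
unfold pd, Gam; simpl; rewrite Derive_scal; apply Rmult_1_l.
Qed.

Theorem lemma8p1 (L T : R) (ur ut uz p : field)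
  (HL : 0 < L) (HT : 0 < T)
  (Heuler : axisymmetric_euler L T ur ut uz p)
  (Hfixed : forall t, 0 <= t < T -> ur 1 0 t = 0 /\ uz 1 0 t = 0)
  (HGam_star : 0 < Gam_star ut)
  (Hb : forall t, 0 <= t < T -> b ut t <> 0)
  (Hodd : forall t, 0 <= t < T -> forall y, uz 1 (- y) t = - uz 1 y t) :
  (forall t, 0 <= t < T -> Q ut t = Q ut 0) /\
  (forall eps : R, Q ut 0 > -1 + eps ->
     forall t, 0 <= t < T ->
       ex_derive (a ur uz) t /\
       Derive (a ur uz) t >=
         sigma_wall uz t * a ur uz t + 2 * eps * (b ut t) ^ 2).
Proof.
destruct (euler_smooth_flow L T ur ut uz p Heuler) as [O F].
assert (Huz : forall t, 0 <= t < T -> uz 1 0 t = 0)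
  by (intros t Ht; exact (proj2 (Hfixed t Ht))).
assert (Hzz : forall t, 0 <= t < T -> pd Cz (pd Cz uz) 1 0 t = 0).
{ intros t Ht; apply (odd_second_derivative (fun y => uz 1 y t)); [| |exact (Hodd t Ht)].
  - intros y; differentiable.
  - apply (ex_derive_pd O (pd Cz uz) Cz 1 0 t); in_flow. }
assert (HQ : forall t, 0 <= t < T -> Q ut t = Q ut 0).
{ apply constant_of_zero_derivative; intros t Ht.
  assert (Hbt := Hb t Ht); rewrite b_Gam in Hbt.
  assert (Db := swirl_z_derivative_at_fixed_point L T ur ut uz p O Heuler F Huz t Ht).
  assert (Dc := swirl_zz_derivative_at_fixed_point L T ur ut uz p O Heuler F Huz t Ht (Hzz t Ht)).
  apply (is_derive_ext
    (fun s => Gam_star ut * (pd Cz (pd Cz ut) 1 0 s / pd Cz ut 1 0 s ^ 2))).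
  { intros s; unfold Q; rewrite b_Gam, Gam_zz; unfold Rdiv.
    symmetry; apply Rmult_assoc. }
  assert (Dq := is_derive_scal _ t (Gam_star ut) _
    (is_derive_growth_ratio _ _ t _ Db Dc Hbt)).
  rewrite Rmult_0_r in Dq; exact Dq. }
split; [exact HQ|].
intros eps Heps t Ht.
assert (Da := a_derivative L T ur ut uz p O Heuler F Huz t Ht).
split; [eexists; exact Da|].
rewrite (is_derive_unique _ _ _ Da).
rewrite <- (HQ t Ht) in Heps; unfold Q in Heps.
rewrite Gam_zz, b_Gam in Heps; rewrite b_Gam.
assert (HG : ut 1 0 t = Gam_star ut).
{ rewrite (constant_of_zero_derivative T (fun s => ut 1 0 s)
    (swirl_derivative_at_fixed_point L T ur ut uz p O Heuler F Huz) t Ht).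
  unfold Gam_star, Gam; ring. }
assert (Hbt := Hb t Ht); rewrite b_Gam in Hbt.
assert (Hb2 : 0 < pd Cz ut 1 0 t ^ 2) by (apply pow2_gt_0; exact Hbt).
rewrite HG.
(* The definition of Q divides by b ^ 2; multiply it back. *)
apply Rgt_lt, (Rmult_lt_compat_r _ _ _ Hb2) in Heps.
unfold Rdiv in Heps; rewrite Rmult_assoc, Rinv_l, Rmult_1_r in Heps by lra.
lra.
Qed.
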